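(* Let $p$ be an odd prime, $m,s$ positive integers, and $\mathcal{R}=\mathbb{F}_{p^m}[u,v]/\langle u^2,v^2,uv-vu\rangle$. Let $\alpha=\alpha_1+\alpha_3v+\alpha_4uv\in\mathcal{R}$ with $\alpha_1,\alpha_3,\alpha_4\in\mathbb{F}_{p^m}^*$, and suppose $\alpha$ is not a square in $\mathcal{R}$. Let $\alpha_0\in\mathbb{F}_{p^m}$ be the element with $\alpha_0^{p^s}=\alpha_1$. Let $\mathcal{C}=\langle (x^2-\alpha_0)^\ell+u(x^2-\alpha_0)^tz(x)\rangle$ be the ideal of $\mathcal{R}_\alpha=\mathcal{R}[x]/\langle x^{2p^s}-\alpha\rangle$, where $0\le\ell\le 2p^s-1$, $0\le t<\ell$, and $z(x)$ is $0$ or a unit. Let $\Im$ be the smallest non-negative integer such that $u(x^2-\alpha_0)^{\Im}\in\mathcal{C}$. Then the symbol-pair distance of $\mathcal{C}$ is $$d_{sp}(\mathcal{C})=\begin{cases}2 & \text{if } 0\le\Im\le p^s;\\ 2(\Gamma+1)p^{\gamma} & \text{if } 2p^s-p^{s-\gamma}+(\Gamma-1)p^{s-\gamma-1}+1\le\Im\le 2p^s-p^{s-\gamma}+\Gamma p^{s-\gamma-1},\\ & \text{where } 1\le\Gamma\le p-1 \text{ and } 0\le\gamma\le s-1.\end{cases}$$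
   Context: Elements of $\mathcal{R}_\alpha=\mathcal{R}[x]/\langle x^{2p^s}-\alpha\rangle$ are identified with vectors in $\mathcal{R}^{2p^s}$: the class whose representative of degree less than $2p^s$ is $\zeta_0+\zeta_1x+\cdots+\zeta_{2p^s-1}x^{2p^s-1}$ corresponds to $(\zeta_0,\ldots,\zeta_{2p^s-1})$. Ideals of $\mathcal{R}_\alpha$ are thereby the $\alpha$-constacyclic codes of length $2p^s$ over $\mathcal{R}$. For vectors $x=(x_0,\ldots,x_{n-1})$, $y=(y_0,\ldots,y_{n-1})$ over an alphabet, the symbol-pair distance is $d_{sp}(x,y)=|\{i:0\le i\le n-1,\ (x_i,x_{i+1})\ne(y_i,y_{i+1})\}|$, indices taken modulo $n$; for a code $\mathcal{C}$ with at least two words, $d_{sp}(\mathcal{C})=\min\{d_{sp}(x,y):x,y\in\mathcal{C},x\ne y\}$. When $z(x)$ is a unit, it is represented as a finite sum $z(x)=\sum_{\kappa}(z_{0\kappa}x+z_{1\kappa})(x^2-\alpha_0)^\kappa$ with $z_{0\kappa},z_{1\kappa}\in\mathbb{F}_{p^m}$ and $z_{00}x+z_{10}\ne0$. *)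

(* Defs.v *)
From HB Require Import structures.
From mathcomp Require Import all_boot all_order all_algebra.

Set Implicit Arguments.
Unset Strict Implicit.
Unset Printing Implicit Defensive.

Import GRing.Theory.
Local Open Scope ring_scope.

(** F[u,v]/<u^2, v^2, uv - vu>, built as (F[u]/<u^2>)[v]/<v^2>; the relation
    uv = vu holds because all the rings below are commutative. *)
Definition u_ring (F : finFieldType) : comNzRingType :=
  {poly %/ ('X^2 : {poly F})}.
Definition uv_ring (F : finFieldType) : comNzRingType :=
  {poly %/ ('X^2 : {poly u_ring F})}.

Definition uvC (F : finFieldType) (a : F) : uv_ring F :=
  qpolyC ('X^2 : {poly u_ring F}) (qpolyC ('X^2 : {poly F}) a).
Definition uvU (F : finFieldType) : uv_ring F :=
  qpolyC ('X^2 : {poly u_ring F}) (qpolyX ('X^2 : {poly F})).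
Definition uvV (F : finFieldType) : uv_ring F :=
  qpolyX ('X^2 : {poly u_ring F}).

(** [qpoly] quotients by the given polynomial only when it is monic and
    nonconstant (by ['X] otherwise), which is the case here as soon as [0 < n]. *)
Definition constacyclic_ring (A : comNzRingType) (n : nat) (a : A) :
    comNzRingType :=
  {poly %/ ('X^n - a%:P : {poly A})}.

Definition ccC (A : comNzRingType) (n : nat) (a : A) (c : A) :
    constacyclic_ring n a :=
  qpolyC ('X^n - a%:P) c.
Definition ccX (A : comNzRingType) (n : nat) (a : A) : constacyclic_ring n a :=
  qpolyX ('X^n - a%:P).

(** An element of a [qpoly] type is its reduced representative, so its
    coefficients of index [< n] are the coordinates of the vector. *)
Definition cc_vec (A : comNzRingType) (n : nat) (a : A)
    (c : constacyclic_ring n a) : 'rV[A]_n :=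
  let c' : {poly %/ ('X^n - a%:P : {poly A})} := c in
  \row_(i < n) (c' : {poly A})`_i.

Definition is_square (A : comNzRingType) (a : A) : Prop :=
  exists b : A, b ^+ 2 = a.

Definition is_unit (A : comNzRingType) (a : A) : Prop :=
  exists b : A, b * a = 1.

Definition principal_ideal (A : comNzRingType) (g : A) : A -> Prop :=
  fun c => exists q : A, c = q * g.

Definition code_of (A : comNzRingType) (n : nat) (a : A)
    (I : constacyclic_ring n a -> Prop) : 'rV[A]_n -> Prop :=
  fun w => exists2 c, I c & w = cc_vec c.

(** [ordS] is the successor modulo [n]. *)
Definition d_sp (T : eqType) (n : nat) (x y : 'rV[T]_n) : nat :=
  #|[set i : 'I_n | (x 0 i, x 0 (ordS i)) != (y 0 i, y 0 (ordS i))]|.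

(** [C] has at least two words and [d] is the minimum of [d_sp x y] over the
    pairs of distinct words of [C]. *)
Definition is_sp_distance (T : eqType) (n : nat) (C : 'rV[T]_n -> Prop)
    (d : nat) : Prop :=
  (exists x y, [/\ C x, C y, x <> y & d_sp x y = d]) /\
  (forall x y, C x -> C y -> x <> y -> (d <= d_sp x y)%N).

Definition is_least (P : nat -> Prop) (k : nat) : Prop :=
  P k /\ (forall j, P j -> (k <= j)%N).

(* Main.v *)
From HB Require Import structures.
Require Import Defs.
From mathcomp Require Import all_boot all_order all_algebra.
From mathcomp Require Import finfield.
From mathcomp Require Import zify ring.
Set Implicit Arguments.
Unset Strict Implicit.
Unset Printing Implicit Defensive.
Import GRing.Theory.
Local Open Scope ring_scope.

(** Write [f = x^2 - a0] and [N = p^s]. As [alpha] is not a square, [f] is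
    irreducible over [F], and [f^N = a3 v + a4 uv], so that [u f^N = a3 uv] and
    [uv f^N = 0]. Every nonzero word has a nonzero multiple [uv h(x)] by a scalar,
    with [h] over [F], whose pair weight is not larger. Such a multiple lies in the
    ideal [C] only if [f^(Im - N)] divides [h], and [uv f^i] lies in [C] as soon as
    [Im <= N + i]. Splitting
    [h = h0(x^2) + x h1(x^2)], the pair weight of [h] is at least twice the Hamming
    weights of [h0] and [h1], which are multiples of [(x - a0)^(Im - N)], with
    equality if [h1 = 0]. What remains is the minimum Hamming weight of the
    multiples of [(x - a0)^k] of degree less than [p^s]. *)

(** * Hamming weights of multiples of powers of [X - a] *)

Section HammingWeight.
Variable R : nzRingType.
Implicit Types p q r : {poly R}.

Definition pwt p : nat := (\sum_(i < size p) (p`_i != 0)%R)%N.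

Lemma pwtE n p : (size p <= n)%N -> pwt p = (\sum_(i < n) (p`_i != 0)%R)%N.
Proof.
move=> sp; rewrite /pwt -!(big_mkord xpredT (fun i => ((p`_i != 0)%R : nat))).
rewrite [RHS](big_cat_nat (n := size p)) //=.
rewrite [X in (_ + X)%N]big_nat_cond [X in (_ + X)%N]big1 ?addn0 //.
by move=> i /andP[/andP[si _] _]; rewrite nth_default ?eqxx.
Qed.

Lemma card_coef_neq0 n p : (size p <= n)%N ->
  #|[set i : 'I_n | p`_i != 0]| = pwt p.
Proof. by move=> sp; rewrite (pwtE sp) -sum1dep_card big_mkcond. Qed.

Lemma pwt_size p : (pwt p <= size p)%N.
Proof.
rewrite -[X in (_ <= X)%N]card_ord -sum1_card.
by apply: leq_sum => i _; case: (_ != _).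
Qed.

Lemma pwt0 : pwt 0 = 0%N.
Proof. by apply/eqP; rewrite -leqn0 (leq_trans (pwt_size 0)) ?size_poly0. Qed.

Lemma pwt_gt0 p : (0 < pwt p)%N = (p != 0).
Proof.
apply/idP/idP => [|p0]; first by apply: contraTneq => ->; rewrite pwt0.
have sp : ((size p).-1 < size p)%N by rewrite ltn_predL size_poly_gt0.
by rewrite /pwt (bigD1 (Ordinal sp)) //= -/(lead_coef p) lead_coef_eq0 p0.
Qed.

(** The supports are disjoint: [r] occupies the exponents below [n], and [q * 'X^n] those from [n]
    on. *)
Lemma pwt_shiftD n q r : (size r <= n)%N -> pwt (r + q * 'X^n) = (pwt r + pwt q)%N.
Proof.
move=> sr; have sq : (size (q * 'X^n)%R <= n + size q)%N.
  by apply: leq_trans (size_polyMleq _ _) _; rewrite size_polyXn addnS addnC.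
have srq : (size (r + q * 'X^n)%R <= n + size q)%N.
  apply: leq_trans (size_polyD _ _) _.
  by rewrite geq_max sq (leq_trans sr) ?leq_addr.
rewrite (pwtE srq) big_split_ord /= (pwtE sr); congr (_ + _)%N.
  by apply: eq_bigr => i _; rewrite coefD coefMXn ltn_ord addr0.
apply: eq_bigr => i _; rewrite coefD coefMXn ltnNge leq_addr /= addKn.
by rewrite nth_default ?add0r // (leq_trans sr) ?leq_addr.
Qed.

Lemma pwtMXn n q : pwt (q * 'X^n) = pwt q.
Proof. by rewrite -[q * _]add0r pwt_shiftD ?size_poly0 // pwt0. Qed.

End HammingWeight.

Section HammingWeightField.
Variable F : fieldType.
Implicit Types c g h : {poly F}.

Lemma pwtZ (k : F) g : pwt (k *: g) = ((k != 0)%R * pwt g)%N.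
Proof.
have [->|k0] := eqVneq k 0; first by rewrite scale0r pwt0.
rewrite mul1n /pwt size_scale //; apply: eq_bigr => i _.
by rewrite coefZ mulf_eq0 (negPf k0).
Qed.

Lemma pwtC (k : F) : pwt k%:P = (k != 0).
Proof.
rewrite -[k%:P]mulr1 mul_polyC pwtZ -[RHS]muln1; congr (_ * _)%N.
by rewrite /pwt size_poly1 big_ord1 coef1 oner_eq0.
Qed.

(** The product is a row of scalar multiples of [g] laid in consecutive blocks of length [n], one
    block per coefficient of [c]; the size bound keeps the blocks from overlapping. *)
Lemma pwt_comp_polyXnM n c g : (size g <= n)%N ->
  pwt ((c \Po 'X^n) * g) = (pwt c * pwt g)%N.
Proof.
move=> sg; elim/poly_ind: c => [|c k IH]; first by rewrite comp_poly0 mul0r pwt0.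
rewrite comp_polyD comp_polyM comp_polyX comp_polyC mulrDl mulrAC mul_polyC.
rewrite addrC pwt_shiftD ?IH; last exact: leq_trans (size_scale_leq _ _) sg.
rewrite [c * 'X + _]addrC -['X]expr1 pwt_shiftD ?size_polyC ?leq_b1 //.
by rewrite pwtZ pwtC mulnDl.
Qed.

Lemma pwt_comp_polyXn n c : (0 < n)%N -> pwt (c \Po 'X^n) = pwt c.
Proof.
move=> n0; rewrite -[_ \Po _]mulr1 pwt_comp_polyXnM ?size_poly1 //.
by rewrite -polyC1 pwtC oner_eq0 muln1.
Qed.

End HammingWeightField.

Lemma exprB_pchar (R : comNzRingType) (p s : nat) (x y : R) : p \in [pchar R] ->
  (x - y) ^+ (p ^ s) = x ^+ (p ^ s) - y ^+ (p ^ s).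
Proof.
move=> pR; have pnat : [pchar R].-nat (p ^ s)%N.
  by rewrite pnatX pnatE ?pR // (pcharf_prime pR).
by rewrite exprDn_pchar // exprNn_pchar.
Qed.

(** * Weights of multiples of powers of ['X - a%:P] in characteristic [p] *)

Section RepeatedRoots.
Variables (F : fieldType) (p : nat).
Hypothesis pF : p \in [pchar F].
Implicit Types (a : F) (g h : {poly F}).

Let p_pr : prime p. Proof. exact: pcharf_prime pF. Qed.
Let p_gt0 : (0 < p)%N. Proof. exact: prime_gt0. Qed.

Lemma XsubC_exp_pchar a s : ('X - a%:P) ^+ (p ^ s) = 'X^(p ^ s) - (a ^+ (p ^ s))%:P.
Proof. by rewrite exprB_pchar ?polyC_exp // pchar_poly. Qed.

Lemma XsubC_expM_pchar a s k :
  ('X - a%:P) ^+ (p ^ s * k) = (('X - (a ^+ (p ^ s))%:P) ^+ k) \Po 'X^(p ^ s).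
Proof.
by rewrite exprM XsubC_exp_pchar !(rmorphXn, rmorphB) /= comp_polyX comp_polyC.
Qed.


(** Each factor ['X - a ^+ p] of [g] becomes ['X^p - a ^+ p], the [p]-th power of ['X - a], while
    the cofactor stays nonzero at [a]. *)
Lemma mup_comp_polyXp a g : g != 0 ->
  mup a (g \Po 'X^p) = (p * mup (a ^+ p) g)%N.
Proof.
move=> g0; have [k [q]] := multiplicity_XsubC g (a ^+ p).
rewrite g0 /= => rq ->; rewrite comp_polyM mupMr; last first.
  by rewrite root_comp hornerXn.
rewrite mupMr // mup_XsubCX eqxx.
by have := XsubC_expM_pchar a 1 k; rewrite expn1 => <-; rewrite mup_XsubCX eqxx.
Qed.

(** The operator multiplies ['X^i] by [i - k], so a suitable [k] removes a chosen term; being of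
    first order, it lowers a multiplicity by at most one. *)
Lemma mup_Euler_leq a (k : F) h : 'X * h^`() - k *: h != 0 ->
  (mup a h <= (mup a ('X * h^`() - k *: h)%R).+1)%N.
Proof.
move=> D0; have h0 : h != 0.
  by apply: contraNneq D0 => ->; rewrite deriv0 scaler0 mulr0 subr0.
case Em: (mup a h) => [//|m]; rewrite ltnS mup_geq //.
have : ('X - a%:P) ^+ m.+1 %| h by rewrite -mup_geq ?Em.
case/dvdpP => q ->; rewrite derivM deriv_exp derivXsubC /= mul1r.
apply: dvdp_sub; last by rewrite scalerAl exprS mulrA dvdp_mulIr.
apply/dvdp_mull/dvdp_add; first by rewrite exprS mulrA dvdp_mulIr.
by rewrite -mulr_natl mulrA dvdp_mulIr.
Qed.

(* Either the exponents of [h] are congruent modulo [p], and [h] is, up to a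
   power of ['X], a polynomial in ['X^p], or ['X * h^`() - e *: h], with [e] the
   degree of [h], is nonzero: it has fewer terms than [h], and its multiplicity
   at [a] has dropped by at most one. *)
Lemma mup_leq_pwt a s h : a != 0 -> h != 0 -> (size h <= p ^ s)%N ->
  (mup a h * p <= (pwt h).-1 * p ^ s)%N.
Proof.
elim: s a h => [|s IHs] a h a0 h0 sh.
  have /size_poly1P[c c0 ->] : size h == 1%N.
    by rewrite eqn_leq sh size_poly_gt0.
  by rewrite mupNroot ?rootC.
have [w] := ubnP (pwt h); elim: w h h0 sh => // w IHw h h0 sh wh.
pose e := (size h).-1; pose D := 'X * h^`() - e%:R *: h.
have cD i : D`_i = (i%:R - e%:R) * h`_i.
  rewrite coefB coefXM coefZ mulrBl; congr (_ - _).
  by case: i => [|i]; rewrite ?mul0r //= coef_deriv mulr_natl.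
have [D0|D0] := eqVneq D 0.
  have hE i : h`_i != 0 -> i = e %[mod p].
    move=> hi; have le_ie : (i <= e)%N.
      rewrite -ltnS prednK ?size_poly_gt0 //.
      by apply: contraNltn hi => ?; rewrite nth_default.
    have /eqP := cD i; rewrite D0 coef0 eq_sym mulf_eq0 (negPf hi) orbF.
    rewrite -oppr_eq0 opprB -natrB // -(dvdn_pcharf pF) -eqn_mod_dvd //.
    by move/eqP.
  (* Dividing the exponents by [p] brings the size bound down to [p ^ s] and turns the point into
     [a ^+ p], so the outer induction applies to [g]. *)
  pose r := (e %% p)%N; pose g := \poly_(i < p ^ s) h`_(i * p + r).
  have gE i : g`_i = h`_(i * p + r).
    rewrite coef_poly; case: ltnP => // le_si; rewrite nth_default //.
    apply: leq_trans sh _; rewrite expnS mulnC.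
    by apply: leq_trans (leq_addr _ _); rewrite leq_mul2r le_si orbT.
  have Dh : h = (g \Po 'X^p) * 'X^r.
    apply/polyP => j; rewrite coefMXn coef_comp_poly_Xn //.
    have [hj|/hE hj] := eqVneq h`_j 0.
      rewrite hj; case: ltnP => // le_rj; case: ifP => // /divnK pj.
      by rewrite gE pj subnK.
    have Ej := divn_eq j p; rewrite hj -/r in Ej.
    by rewrite {2 3 4}Ej ltnNge leq_addl /= addnK dvdn_mull // mulnK // gE -Ej.
  have g0 : g != 0 by apply: contraNneq h0 => g0; rewrite Dh g0 comp_poly0 mul0r.
  rewrite Dh pwtMXn pwt_comp_polyXn // mupMl ?mup_comp_polyXp //; last first.
    by rewrite /root hornerXn expf_neq0.
  rewrite -mulnA expnS [leqRHS]mulnCA leq_pmul2l //.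
  by apply: IHs; rewrite ?expf_neq0 // size_poly.
have sD : (size D <= size h)%N.
  by apply/leq_sizeP => i; rewrite cD => /leq_sizeP-> //; rewrite mulr0.
have wD : (pwt D < pwt h)%N.
  have lt_e : (e < size h)%N by rewrite ltn_predL size_poly_gt0.
  rewrite (pwtE sD) [pwt h]/pwt (bigD1 (Ordinal lt_e)) //=.
  rewrite [X in (_ < X)%N](bigD1 (Ordinal lt_e)) //= cD subrr mul0r eqxx add0n.
  rewrite -/(lead_coef h) lead_coef_eq0 h0 add1n ltnS.
  apply: leq_sum => i _; rewrite cD mulf_eq0 negb_or.
  by case: (h`_i != 0); rewrite ?andbF ?leq_b1.
have IH := IHw D D0 (leq_trans sD sh) (leq_trans wD (ltnSE wh)).
have := mup_Euler_leq a D0; rewrite -/D => mD.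
have pps : (p <= p ^ s.+1)%N by rewrite expnS leq_pmulr // expn_gt0 p_gt0.
have wD0 : (0 < pwt D)%N by rewrite pwt_gt0.
(* The lost unit of multiplicity costs [p] on the left; the lost term pays at least [p ^ s.+1] on
   the right. *)
apply: (@leq_trans ((mup a D).+1 * p)); first by rewrite leq_mul2r mD orbT.
apply: (@leq_trans (pwt D * p ^ s.+1)); last by rewrite leq_mul2r; lia.
rewrite -(prednK wD0) !mulSn; apply: leq_add => //; apply: IH; lia.
Qed.

Lemma leq_pwt_XsubC_exp a : a != 0 -> (p <= pwt (('X - a%:P) ^+ p.-1))%N.
Proof.
move=> a0; set h := _ ^+ _.
have h0 : h != 0 by rewrite expf_neq0 ?polyXsubC_eq0.
have sh : (size h <= p ^ 1)%N by rewrite size_exp_XsubC prednK.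
have := mup_leq_pwt a0 h0 sh.
rewrite mup_XsubCX eqxx expn1 leq_pmul2r //.
by have := pwt_gt0 h; rewrite h0; lia.
Qed.

(** Induction on [d], starting from [mup_leq_pwt]. In the inductive step the factor with exponent
    [M * p.-1] splits off. The size of [h] leaves at most [M] for the cofactor, so weights multiply
    and each step contributes a factor [p]. *)
Lemma leq_pwt_dvdp a s d k h : a != 0 -> h != 0 -> (size h <= p ^ (d + s.+1))%N ->
    ('X - a%:P) ^+ (p ^ (d + s.+1) - p ^ s.+1 + k * p ^ s).+1 %| h ->
  (k.+2 * p ^ d <= pwt h)%N.
Proof.
move=> a0; elim: d h => [|d IHd] h h0 sh.
  rewrite add0n subnn add0n -mup_geq // expn0 muln1 => lt_k.
  have := mup_leq_pwt a0 h0 sh; rewrite add0n expnS => le_w.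
  have : ((k * p ^ s).+1 * p <= (pwt h).-1 * (p * p ^ s))%N.
    by apply: leq_trans le_w; rewrite leq_mul2r lt_k orbT.
  rewrite [leqRHS]mulnCA mulnC leq_pmul2l // ltn_mul2r => /andP[_].
  lia.
set M := (p ^ (d + s.+1))%N in IHd *.
have M_gt0 : (0 < M)%N by rewrite expn_gt0 p_gt0.
have sM : (p ^ s.+1 <= M)%N by rewrite leq_pexp2l // leq_addl.
have pM : (p ^ (d.+1 + s.+1) = M * p.-1 + M)%N.
  by rewrite addSn expnS -/M -mulnSr prednK // mulnC.
rewrite pM in sh *.
have -> : (M * p.-1 + M - p ^ s.+1 + k * p ^ s).+1 =
  ((M - p ^ s.+1 + k * p ^ s).+1 + M * p.-1)%N.
  by rewrite -addnBA // -addnA addnC.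
rewrite exprD => /dvdpP[q]; rewrite mulrA => Dh.
set h' := q * _ in Dh.
have h'0 : h' != 0 by apply: contraNneq h0 => h'0; rewrite Dh h'0 mul0r.
have sh' : (size h' <= M)%N.
  move: sh; rewrite Dh size_mul ?expf_neq0 ?polyXsubC_eq0 // size_exp_XsubC.
  by rewrite addnS /= addnC leq_add2l.
(* [('X - a%:P) ^+ (M * p.-1)] is a polynomial in ['X^M] with [p] terms. *)
rewrite Dh mulrC XsubC_expM_pchar pwt_comp_polyXnM // expnS mulnCA.
apply: leq_mul; first by rewrite leq_pwt_XsubC_exp ?expf_neq0.
by apply: IHd => //; rewrite dvdp_mull.
Qed.

(** The power splits into a polynomial in ['X^(p ^ s.+1)] with at most [p ^ d] terms and one in
    ['X^(p ^ s)] with at most [k.+1] terms. As [k < p], the latter has size at most [p ^ s.+1], so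
    the weights multiply. *)
Lemma pwt_XsubC_exp_leq a s d k : (k < p)%N ->
  (pwt (('X - a%:P) ^+ (p ^ (d + s.+1) - p ^ s.+1 + k * p ^ s)) <= k.+1 * p ^ d)%N.
Proof.
move=> lt_kp; have pg_gt0 : (0 < p ^ d)%N by rewrite expn_gt0 p_gt0.
have -> : (p ^ (d + s.+1) - p ^ s.+1 = p ^ s.+1 * (p ^ d).-1)%N.
  by rewrite addnC expnD -subn1 mulnBr muln1.
rewrite exprD XsubC_expM_pchar pwt_comp_polyXnM; last first.
  rewrite size_exp_XsubC expnS; apply: leq_ltn_trans (_ : (k * p ^ s < _)%N) => //.
  by rewrite ltn_pmul2r // expn_gt0 p_gt0.
rewrite [(k * _)%N]mulnC XsubC_expM_pchar pwt_comp_polyXn; last first.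
  by rewrite expn_gt0 p_gt0.
rewrite mulnC leq_mul // (leq_trans (pwt_size _)) // size_exp_XsubC //.
by rewrite prednK.
Qed.

End RepeatedRoots.

(** * Pair weight and the even and odd parts of a polynomial *)

Section EvenOdd.
Variable F : comNzRingType.
Implicit Types g h : {poly F}.

Lemma even_poly_comp_Xsq g : even_poly (g \Po 'X^2) = g.
Proof.
apply/polyP => i; rewrite coef_even_poly coef_comp_poly_Xn // -muln2.
by rewrite dvdn_mull // mulnK.
Qed.

Lemma odd_poly_comp_Xsq g : odd_poly (g \Po 'X^2) = 0.
Proof.
apply/polyP => i; rewrite coef_odd_poly coef_comp_poly_Xn // coef0.
by rewrite dvdn2 /= odd_double.
Qed.

(** Multiplying by a polynomial in ['X^2] preserves the parity of exponents, so it acts on the even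
    and odd parts separately. *)
Lemma even_poly_comp_XsqM g h : even_poly ((g \Po 'X^2) * h) = g * even_poly h.
Proof.
rewrite -{1}[h]poly_even_odd mulrDr mulrA -!comp_polyM even_polyD even_polyMX.
by rewrite even_poly_comp_Xsq odd_poly_comp_Xsq mul0r addr0.
Qed.

Lemma odd_poly_comp_XsqM g h : odd_poly ((g \Po 'X^2) * h) = g * odd_poly h.
Proof.
rewrite -{1}[h]poly_even_odd mulrDr mulrA -!comp_polyM odd_polyD odd_polyMX.
by rewrite even_poly_comp_Xsq odd_poly_comp_Xsq add0r.
Qed.

End EvenOdd.

Section PairDistance.
Variable T : eqType.

Lemma d_sp_setE n (x y : 'rV[T]_n) (E := [set i | x 0 i != y 0 i]) :
  d_sp x y = #|E :|: @ordS n @^-1: E|.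
Proof.
rewrite /d_sp; congr #|pred_of_set _|; apply/setP => i.
by rewrite !inE xpair_eqE negb_and.
Qed.

Lemma d_sp_leq n (x y : 'rV[T]_n) :
  (d_sp x y <= 2 * #|[set i | x 0%R i != y 0%R i]|)%N.
Proof.
rewrite d_sp_setE (leq_trans (leq_card_setU _ _)) //.
by rewrite (card_preimset _ (@ordS_inj n)) mul2n addnn.
Qed.

(* A position of support of parity [b] meets the two pairs [(i - 1, i)] and
   [(i, i + 1)], and the pairs of two distinct such positions are distinct. *)
Lemma d_sp_geq n (x y : 'rV[T]_(2 * n)) (b : bool) :
  (2 * #|[set i : 'I_(2 * n) | (x 0%R i != y 0%R i) && (odd i == b)]| <= d_sp x y)%N.
Proof.
set E := [set i | _ && _].
have dis : [disjoint E & @ordS _ @^-1: E].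
  rewrite -setI_eq0; apply/eqP/setP => i; rewrite !inE /=.
  (* The length is even, so the cyclic successor changes parity even at the wrap-around. *)
  rewrite odd_mod ?oddM //=.
  by case: (odd i); case: (b); rewrite ?andbF.
rewrite d_sp_setE mul2n -addnn -[X in (_ + X)%N](card_preimset _ (@ordS_inj _)).
have := leq_card_setU E (@ordS _ @^-1: E); rewrite dis => /leqifP/eqP<-.
by apply/subset_leq_card/setUSS/preimsetS; apply/subsetP => i;
  rewrite !inE => /andP[].
Qed.

End PairDistance.

Section PolynomialWords.
Variables (F : fieldType) (T : eqType) (n : nat) (x y : 'rV[T]_(2 * n)).
Variable h : {poly F}.
Hypothesis sh : (size h <= 2 * n)%N.

Lemma d_sp_leq_pwt : (forall i : 'I_(2 * n), x 0 i != y 0 i -> h`_i != 0) ->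
  (d_sp x y <= 2 * pwt h)%N.
Proof.
move=> xyh; apply: leq_trans (d_sp_leq _ _) _; rewrite leq_mul2l /=.
rewrite -(card_coef_neq0 sh); apply/subset_leq_card/subsetP => i.
by rewrite !inE; apply: xyh.
Qed.

Hypothesis hxy : forall i : 'I_(2 * n), h`_i != 0 -> x 0 i != y 0 i.

Lemma d_sp_geq_pwt_aux (b : bool) (g : {poly F}) :
    (forall i, g`_i = if odd i == b then h`_i else 0) ->
  (2 * pwt g <= d_sp x y)%N.
Proof.
move=> gE; apply: leq_trans (d_sp_geq x y b); rewrite leq_mul2l /=.
have sg : (size g <= 2 * n)%N.
  apply/leq_sizeP => i le_i; rewrite gE nth_default ?if_same //.
  exact: leq_trans sh le_i.
rewrite -(card_coef_neq0 sg); apply/subset_leq_card/subsetP => i.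
rewrite !inE gE; case: ifP => //; last by rewrite eqxx.
by rewrite andbT => _; apply: hxy.
Qed.

Lemma d_sp_geq_even : (2 * pwt (even_poly h) <= d_sp x y)%N.
Proof.
rewrite -(pwt_comp_polyXn (even_poly h) (isT : (0 < 2)%N)).
apply: (d_sp_geq_pwt_aux (b := false)) => i.
rewrite coef_comp_poly_Xn // dvdn2 eqbF_neg; case: ifP => // i_even.
by rewrite coef_even_poly divn2 even_halfK.
Qed.

Lemma d_sp_geq_odd : (2 * pwt (odd_poly h) <= d_sp x y)%N.
Proof.
rewrite -(pwt_comp_polyXn (odd_poly h) (isT : (0 < 2)%N)) -(pwtMXn 1).
apply: (d_sp_geq_pwt_aux (b := true)) => i.
rewrite expr1 coefMX eqb_id; case: i => [|i] //=.
rewrite coef_comp_poly_Xn // dvdn2; case: ifP => // i_even.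
by rewrite coef_odd_poly divn2 even_halfK.
Qed.

(** Both parts of [h] are multiples of [e] of size at most [n], and at least one is nonzero; the
    weight bound is applied to that one. *)
Lemma d_sp_geq_pwt (e : {poly F}) (d : nat) : h != 0 -> (e \Po 'X^2) %| h ->
    (forall g : {poly F}, g != 0 -> (size g <= n)%N -> e %| g -> (d <= pwt g)%N) ->
  (2 * d <= d_sp x y)%N.
Proof.
move=> h0 /dvdpP[q Dh] dP.
have e_even : e %| even_poly h by rewrite Dh mulrC even_poly_comp_XsqM dvdp_mulr.
have e_odd : e %| odd_poly h by rewrite Dh mulrC odd_poly_comp_XsqM dvdp_mulr.
have [e0|e0] := eqVneq (even_poly h) 0; last first.
  apply: leq_trans d_sp_geq_even; rewrite leq_mul2l /=; apply: dP => //.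
  by apply: leq_trans (size_even_poly _) _; lia.
have o0 : odd_poly h != 0.
  by apply: contraNneq h0 => o0; rewrite -[h]poly_even_odd e0 o0 !comp_poly0 mul0r addr0.
apply: leq_trans d_sp_geq_odd; rewrite leq_mul2l /=; apply: dP => //.
by apply: leq_trans (size_odd_poly _) _; lia.
Qed.

End PolynomialWords.

(** * Dual numbers and constacyclic codes *)

Section QuotientPolynomials.
Variables (A : comNzRingType) (h : {poly A}).

Lemma in_qpolyC c : in_qpoly h c%:P = qpolyC h c.
Proof. by apply/val_inj/in_qpoly_small; rewrite (size_mk_monic (qpolyC h c)). Qed.

Lemma in_qpolyK (q : {poly %/ h}) : in_qpoly h q = q.
Proof. by apply/val_inj/in_qpoly_small/size_mk_monic. Qed.

Lemma val_qpolyCM c (q : {poly %/ h}) :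
  (qpolyC h c * q : {poly %/ h}) = c *: (q : {poly A}) :> {poly A}.
Proof.
rewrite -mul_polyC; apply: in_qpoly_small; rewrite mul_polyC.
exact: leq_ltn_trans (size_scale_leq _ _) (size_mk_monic q).
Qed.

Lemma in_qpoly_modulus : h \is monic -> (1 < size h)%N -> in_qpoly h h = 0.
Proof.
move=> h_mon sh; apply/val_inj; rewrite /= /mk_monic sh h_mon /=.
exact: Pdiv.RingMonic.rmodpp.
Qed.

End QuotientPolynomials.

Section DualNumbers.
Variable A : comNzRingType.

Notation dual := {poly %/ ('X^2 : {poly A})}.
Notation inA := (qpolyC ('X^2 : {poly A})).
Notation eps := (qpolyX ('X^2 : {poly A})).
Implicit Type d : dual.

Lemma mul_eps_eps : eps * eps = 0.
Proof.
rewrite -rmorphM -expr2 /= in_qpoly_modulus ?monicXn //.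
by rewrite size_polyXn.
Qed.

Lemma dualE d : d = inA (d : {poly A})`_0 + eps * inA (d : {poly A})`_1.
Proof.
rewrite -!in_qpolyC -rmorphM -rmorphD /= -[LHS]in_qpolyK; congr in_qpoly.
apply/polyP => -[|[|i]]; rewrite coefD coefXM !coefC ?addr0 ?add0r //=.
rewrite nth_default // (leq_trans _ (_ : 2 <= i.+2)%N) // -ltnS.
by apply: leq_trans (size_mk_monic d) _; rewrite mk_monic_Xn size_polyXn.
Qed.

Lemma mul_eps_inA_eq0 a : eps * inA a = 0 -> a = 0.
Proof.
rewrite -in_qpolyC -rmorphM /= => /(congr1 (fun d : dual => (d : {poly A})`_1)).
rewrite in_qpoly_small ?coefXM ?coefC //=.
rewrite mk_monic_Xn size_polyXn ltnS (leq_trans (size_polyMleq _ _)) //.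
by rewrite size_polyX size_polyC; case: (a != 0).
Qed.

(** If all constant parts vanish, [c] is already a multiple of [eps]; otherwise multiplying by [eps]
    erases the [eps] parts and keeps the constant ones. *)
Lemma dual_poly_socle (c : {poly dual}) : c != 0 ->
  exists a (g : {poly A}), g != 0 /\ a *: c = eps *: map_poly inA g.
Proof.
move=> c0; pose g k := \poly_(i < size c) ((c`_i : dual) : {poly A})`_k.
have gE k i : (g k)`_i = ((c`_i : dual) : {poly A})`_k.
  rewrite coef_poly; case: ltnP => // le_i.
  by rewrite [c`_i]nth_default ?coef0.
have [g0|g0] := eqVneq (g 0%N) 0.
  have cE : c = eps *: map_poly inA (g 1%N).
    apply/polyP => i; rewrite coefZ coef_map /= gE [LHS]dualE.
    by rewrite -(gE 0%N) g0 coef0 raddf0 add0r.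
  exists 1, (g 1%N); rewrite scale1r; split=> //.
  by apply: contraNneq c0 => g1; rewrite cE g1 map_poly0 scaler0.
exists eps, (g 0%N); split=> //; apply/polyP => i.
by rewrite !coefZ coef_map /= gE {1}[c`_i]dualE mulrDr mulrA mul_eps_eps mul0r addr0.
Qed.

End DualNumbers.

Section Codes.
Variables (A : comNzRingType) (n : nat) (a : A).

Definition cc_poly (c : constacyclic_ring n a) : {poly A} :=
  (c : {poly %/ ('X^n - a%:P : {poly A})}).

Lemma cc_vecE c i : cc_vec c 0 i = (cc_poly c)`_i.
Proof. by rewrite mxE. Qed.

Lemma cc_polyCM b (c : constacyclic_ring n a) :
  cc_poly (ccC n a b * c) = b *: cc_poly c.
Proof. exact: val_qpolyCM. Qed.

Hypothesis n_gt0 : (0 < n)%N.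

Let mk_monicP : mk_monic ('X^n - a%:P) = 'X^n - a%:P.
Proof. by rewrite /mk_monic size_XnsubC // ltnS n_gt0 monicXnsubC. Qed.

Lemma size_cc_poly c : (size (cc_poly c) <= n)%N.
Proof.
by rewrite -ltnS; apply: leq_trans (size_mk_monic c) _; rewrite mk_monicP size_XnsubC.
Qed.

Lemma cc_poly_in_qpoly (g : {poly A}) : (size g <= n)%N ->
  cc_poly (in_qpoly ('X^n - a%:P) g) = g.
Proof. by move=> sg; apply: in_qpoly_small; rewrite mk_monicP size_XnsubC. Qed.

Lemma ccX_exp : ccX n a ^+ n = ccC n a a.
Proof.
rewrite /ccX /ccC /qpolyX -in_qpolyC.
rewrite -rmorphXn /= -[X in in_qpoly _ X](subrK a%:P) rmorphD /=.
by rewrite in_qpoly_modulus ?add0r ?monicXnsubC // size_XnsubC.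
Qed.

Lemma cc_vecB (c d : constacyclic_ring n a) : cc_vec (c - d) = cc_vec c - cc_vec d.
Proof. by apply/rowP => i; rewrite !mxE coefB. Qed.

Lemma d_sp_subr (x y : 'rV[A]_n) : d_sp x y = d_sp (x - y) 0.
Proof.
apply: eq_card => i; rewrite !inE !mxE !xpair_eqE.
by rewrite !subr_eq0.
Qed.

Lemma principal_idealM (q g c : constacyclic_ring n a) :
  principal_ideal g c -> principal_ideal g (q * c).
Proof. by case=> r ->; exists (q * r); rewrite mulrA. Qed.

Lemma principal_idealD (g c d : constacyclic_ring n a) :
  principal_ideal g c -> principal_ideal g d -> principal_ideal g (c + d).
Proof. by case=> q -> [r ->]; exists (q + r); rewrite mulrDl. Qed.

(** An ideal is closed under differences, so the minimum distance is the minimum pair weight of a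
    nonzero word. *)
Lemma is_sp_distance_ideal (g c0 : constacyclic_ring n a) (d : nat) :
    (0 < d)%N -> principal_ideal g c0 -> c0 != 0 ->
    (d_sp (cc_vec c0) 0 <= d)%N ->
    (forall c, principal_ideal g c -> c != 0 -> (d <= d_sp (cc_vec c) 0)%N) ->
  is_sp_distance (code_of (principal_ideal g)) d.
Proof.
move=> d_gt0 Cc0 c0_neq0 le_d ge_d.
have Ed : d_sp (cc_vec c0) 0 = d by apply/eqP; rewrite eqn_leq le_d ge_d.
have cc_vec0 : cc_vec (0 : constacyclic_ring n a) = 0.
  by apply/rowP => i; rewrite !mxE coef0.
split=> [|_ _ [c Cc ->] [c' Cc' ->] ne_cc'].
  exists (cc_vec c0), 0; split=> //; first by exists c0.
    by exists 0; [exists 0; rewrite mul0r | rewrite cc_vec0].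
  move=> v0; move: d_gt0; rewrite -Ed v0 d_sp_subr subrr lt0n.
  case/eqP; apply/eqP; rewrite /d_sp cards_eq0; apply/eqP/setP => i.
  by rewrite !inE eqxx.
rewrite d_sp_subr -cc_vecB; apply: ge_d.
  by rewrite -[- c']mulN1r; apply/principal_idealD/principal_idealM.
by rewrite subr_eq0; apply: contra_notN ne_cc' => /eqP->.
Qed.

End Codes.

(** * The constacyclic ring over F[u,v]/<u^2, v^2, uv - vu> *)

Lemma dual_dual_poly_socle (A : comNzRingType)
    (inA := qpolyC ('X^2 : {poly A}))
    (inD := qpolyC ('X^2 : {poly {poly %/ ('X^2 : {poly A})}}))
    (c : {poly {poly %/ ('X^2 : {poly {poly %/ ('X^2 : {poly A})}})}}) :
  c != 0 -> exists a (h : {poly A}),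
    h != 0 /\ a *: c = (inD (qpolyX _) * qpolyX _) *: map_poly (inD \o inA) h.
Proof.
move=> /dual_poly_socle[a [g [/dual_poly_socle[b [h [h0 bg]]] ag]]].
(* The scalar [a] moves [c] into the multiples of the outer generator, then [b] moves what remains
   into the multiples of the inner one. *)
exists (qpolyC _ b * a), h; split=> //.
rewrite -[LHS]scalerA ag [LHS]scalerA [X in X *: _ = _]mulrC.
rewrite [X in _ = X *: _]mulrC -[LHS]scalerA -[RHS]scalerA; congr (_ *: _).
have := congr1 (map_poly inD) bg; rewrite !map_polyZ /= => ->.
by rewrite [in RHS]map_poly_comp.
Qed.

Section UVRing.
Variable F : finFieldType.

HB.instance Definition _ := GRing.RMorphism.copy (@uvC F)
  (qpolyC ('X^2 : {poly u_ring F}) \o qpolyC ('X^2 : {poly F})).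

Lemma mul_uvU_uvU : uvU F * uvU F = 0.
Proof. by rewrite /uvU -qpolyCM mul_eps_eps raddf0. Qed.

Lemma mul_uvV_uvV : uvV F * uvV F = 0.
Proof. exact: mul_eps_eps. Qed.

Lemma mul_uvU_uvV_uvC_eq0 (a : F) : uvU F * uvV F * uvC a = 0 -> a = 0.
Proof.
rewrite mulrAC /uvU /uvC -qpolyCM mulrC => /mul_eps_inA_eq0.
exact: mul_eps_inA_eq0.
Qed.

Lemma uv_poly_socle (c : {poly uv_ring F}) : c != 0 ->
  exists a (h : {poly F}), h != 0 /\ a *: c = (uvU F * uvV F) *: map_poly (@uvC F) h.
Proof. by move/dual_dual_poly_socle. Qed.

(** Since [v ^ 2 = 0], a root [c] of the constant part lifts: adding the other two terms divided by
    [2 c] produces them as the cross terms of the square. *)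
Lemma uv_is_square (a3 a4 c : F) : c != 0 -> 2%:R != 0 :> F ->
  is_square (uvC (c ^+ 2) + uvC a3 * uvV F + uvC a4 * (uvU F * uvV F)).
Proof.
move=> c0 two0.
have double_half b : b = c * (b / (2%:R * c)) *+ 2.
  by rewrite -mulrnAl -mulr_natl mulrC divfK ?mulf_neq0.
exists (uvC c + uvC (a3 / (2%:R * c)) * uvV F
              + uvC (a4 / (2%:R * c)) * (uvU F * uvV F)).
rewrite [in RHS](double_half a3) [in RHS](double_half a4).
move: (a3 / _) (a4 / _) => b3 b4; rewrite !(rmorphMn, rmorphM, rmorphXn) /=.
have sqE (x y z u v : uv_ring F) :
    (x + y * v + z * (u * v)) ^+ 2 =
    x ^+ 2 + (x * y) *+ 2 * v + (x * z) *+ 2 * (u * v) + v * v * (y + z * u) ^+ 2.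
  by ring.
by rewrite sqE mul_uvV_uvV mul0r addr0.
Qed.

End UVRing.

Section ConstacyclicRing.
Variables (p s : nat) (F : finFieldType) (a1 a3 a4 a0 : F).
Hypothesis pF : p \in [pchar F].
Hypothesis p_odd : odd p.
Hypotheses (a1_neq0 : a1 != 0) (a3_neq0 : a3 != 0).
Hypothesis a0E : a0 ^+ (p ^ s) = a1.
Let alpha : uv_ring F := uvC a1 + uvC a3 * uvV F + uvC a4 * (uvU F * uvV F).
Hypothesis alpha_nsq : ~ is_square alpha.
Let N := (p ^ s)%N.
Let n := (2 * N)%N.
Local Notation CC := (constacyclic_ring n alpha).

Let N_gt0 : (0 < N)%N.
Proof. by rewrite expn_gt0 prime_gt0 // (pcharf_prime pF). Qed.

Let n_gt0 : (0 < n)%N.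
Proof. by rewrite muln_gt0. Qed.

Definition of_poly : {poly F} -> CC := in_qpoly ('X^n - alpha%:P) \o map_poly (@uvC F).

HB.instance Definition _ := GRing.RMorphism.copy of_poly
  (in_qpoly ('X^n - alpha%:P) \o map_poly (@uvC F)).

Lemma of_polyC b : of_poly b%:P = ccC n alpha (uvC b).
Proof. by rewrite /of_poly /= map_polyC /= in_qpolyC. Qed.

Lemma of_polyX : of_poly 'X = ccX n alpha.
Proof. by rewrite /of_poly /= map_polyX. Qed.

Lemma of_poly_exp h k : of_poly (h ^+ k) = of_poly h ^+ k.
Proof. exact: rmorphXn. Qed.

Lemma of_polyD h k : of_poly (h + k) = of_poly h + of_poly k.
Proof. exact: rmorphD. Qed.

Lemma of_polyM h k : of_poly (h * k) = of_poly h * of_poly k.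
Proof. exact: rmorphM. Qed.

(** A root [b] would make [a1] the square of [b ^+ (p ^ s)], and then [alpha] would be a square. *)
Lemma irreducible_XsqsubC : irreducible_poly ('X^2 - a0%:P).
Proof.
have two0 : 2%:R != 0 :> F.
  rewrite -(dvdn_pcharf pF) dvdn_prime2 ?(pcharf_prime pF) //.
  by apply: contraL p_odd => /eqP->.
apply: cubic_irreducible => [|b]; first by rewrite size_XnsubC.
apply/negP => /rootP; rewrite !hornerE => /eqP; rewrite subr_eq0 => /eqP b2.
apply: alpha_nsq; rewrite /alpha -a0E -b2 -exprM mulnC exprM.
apply: uv_is_square => //; rewrite expf_neq0 //; apply: contraNneq a1_neq0 => b0.
by rewrite -a0E -b2 b0 expr0n /= expr0n gtn_eqF.
Qed.

Local Notation f := ('X^2 - a0%:P : {poly F}).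
Local Notation UV := (ccC n alpha (uvU F * uvV F)).
Local Notation cst b := (ccC n alpha (uvC b)).

Lemma ccCM (b c : uv_ring F) : ccC n alpha (b * c) = ccC n alpha b * ccC n alpha c.
Proof. exact: qpolyCM. Qed.

(** By the Frobenius map, [f ^+ N] is ['X^n - a1], and ['X^n] becomes [alpha]. *)
Lemma of_poly_XsqsubC_exp :
  of_poly (f ^+ N) = ccC n alpha (uvC a3 * uvV F + uvC a4 * (uvU F * uvV F)).
Proof.
rewrite exprB_pchar ?pchar_poly // -exprM -polyC_exp a0E rmorphB rmorphXn.
rewrite /= of_polyC of_polyX ccX_exp //.
rewrite -[LHS](raddfB (qpolyC ('X^n - alpha%:P))); congr qpolyC.
by rewrite /alpha; ring.
Qed.

(** Up to the unit [a3], this exchanges [U * f ^+ (N + j)], on which [Im] gives information, with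
    [UV * f ^+ j], whose weight is that of a polynomial over [F]. *)
Lemma mul_uvU_of_poly_exp j :
  ccC n alpha (uvU F) * of_poly f ^+ (N + j) = cst a3 * (UV * of_poly f ^+ j).
Proof.
have UE (x y : uv_ring F) :
    uvU F * (x * uvV F + y * (uvU F * uvV F)) = x * (uvU F * uvV F).
  rewrite mulrDr mulrCA [uvU F * (y * _)]mulrCA [uvU F * (uvU F * _)]mulrA.
  by rewrite mul_uvU_uvU mul0r mulr0 addr0.
by rewrite exprD -of_poly_exp of_poly_XsqsubC_exp [LHS]mulrA -ccCM UE ccCM mulrA.
Qed.

Lemma mul_uvUV_of_poly_exp : UV * of_poly (f ^+ N) = 0.
Proof.
rewrite of_poly_XsqsubC_exp -ccCM -[RHS](raddf0 (qpolyC _)); congr qpolyC.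
have -> (x y : uv_ring F) : uvU F * uvV F * (x * uvV F + y * (uvU F * uvV F))
  = uvV F * uvV F * (uvU F * x + uvU F * uvU F * y) by ring.
by rewrite mul_uvV_uvV mul0r.
Qed.

Lemma coef_uvUV_of_poly (h : {poly F}) : (size h <= n)%N ->
  cc_poly (UV * of_poly h) = (uvU F * uvV F) *: map_poly (@uvC F) h.
Proof.
by move=> sh; rewrite cc_polyCM cc_poly_in_qpoly // (leq_trans (size_poly _ _)).
Qed.

Lemma uvUV_of_poly_neq0 (h : {poly F}) : (size h <= n)%N -> h != 0 -> UV * of_poly h != 0.
Proof.
move=> sh; apply: contraNneq => UVh0; apply/eqP/polyP => i.
have := coef_uvUV_of_poly sh; rewrite UVh0 => /(congr1 (fun g : {poly _} => g`_i)).
rewrite coefZ coef_map /= [X in X = _]coef0 => /esym/mul_uvU_uvV_uvC_eq0.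
by rewrite coef0.
Qed.

(** A scalar acts coefficientwise, so it creates no new support: [h] inherits from [c] both its size
    bound and its zero positions. *)
Lemma uvUV_socle (c : CC) : c != 0 ->
  exists b (h : {poly F}), [/\ h != 0, (size h <= n)%N,
    ccC n alpha b * c = UV * of_poly h &
    forall i, h`_i != 0 -> (cc_poly c)`_i != 0].
Proof.
move=> c0; have /uv_poly_socle[b [h [h0 bc]]] : cc_poly c != 0 by [].
have hc i : h`_i != 0 -> (cc_poly c)`_i != 0.
  apply: contraNneq => ci0; apply/eqP/mul_uvU_uvV_uvC_eq0.
  have := congr1 (fun q : {poly _} => q`_i) bc.
  by rewrite !coefZ coef_map /= ci0 mulr0 => <-.
have sh : (size h <= n)%N.
  apply: leq_trans (size_cc_poly n_gt0 c); rewrite leqNgt; apply/negP => lt_s.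
  have := hc (size h).-1; rewrite -/(lead_coef h) lead_coef_eq0 h0 => /(_ isT).
  by rewrite nth_default ?eqxx // -ltnS prednK // (leq_ltn_trans _ lt_s).
have bcE : cc_poly (ccC n alpha b * c) = cc_poly (UV * of_poly h).
  by rewrite cc_polyCM coef_uvUV_of_poly.
by exists b, h; split=> //; apply: val_inj.
Qed.

(** * Membership in the ideal and its pair distance *)

Variables (g : CC) (Im : nat).
Let C : CC -> Prop := principal_ideal g.
Hypothesis Im_least :
  is_least (fun k => C (ccC n alpha (uvU F) * of_poly f ^+ k)) Im.

Lemma uvUV_exp_mem j : (Im <= N + j)%N -> C (UV * of_poly f ^+ j).
Proof.
case: Im_least => CIm _ le_Im.
have -> : UV * of_poly f ^+ j
  = cst a3^-1 * of_poly f ^+ (N + j - Im) * (ccC n alpha (uvU F) * of_poly f ^+ Im).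
  rewrite mulrCA mulrA -mulrA -mulrA -exprD subnK // mulrCA mul_uvU_of_poly_exp.
  rewrite [RHS]mulrA -ccCM -[uvC _ * _]rmorphM mulVf // rmorph1.
  by rewrite [ccC _ _ 1](rmorph1 (qpolyC _)) mul1r.
exact: principal_idealM.
Qed.

(* Otherwise [h] has the form [f ^+ k * q] with [q] coprime to [f] and
   [N + k < Im], and inverting [q] modulo [f ^+ N] puts [UV * f ^+ k], hence
   [U * f ^+ (N + k)], in the code. *)
Lemma uvUV_mem_dvdp (h : {poly F}) j :
  C (UV * of_poly h) -> (N + j <= Im)%N -> f ^+ j %| h.
Proof.
move=> Ch; elim: j => [|j IHj] le_Im; first by rewrite expr0 dvd1p.
have /dvdpP[q Dh] : f ^+ j %| h by apply: IHj; lia.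
have [fq|] := boolP (f %| q); first by rewrite Dh exprS dvdp_mul.
rewrite -(irreducible_poly_coprime _ irreducible_XsqsubC) coprimep_sym => cqf.
have /Bezout_coprimepP[[u v] /= uv1] := coprimep_expr N cqf.
have /size_poly1P[k k0 Dk] : size (u * q + v * f ^+ N) == 1%N.
  by rewrite size_poly_eq1.
(* This is the Bezout identity times [f ^+ j / k]: the first term is a multiple of [h], and the
   second is annihilated by [UV]. *)
have fjE : f ^+ j = k^-1%:P * u * h + k^-1%:P * v * f ^+ j * f ^+ N.
  transitivity (k^-1%:P * (u * q + v * f ^+ N) * f ^+ j).
    by rewrite Dk -polyCM mulVf // mul1r.
  by rewrite Dh; move: (f ^+ j) (f ^+ N) => fj fN; ring.
have CUVf : C (UV * of_poly f ^+ j).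
  rewrite -of_poly_exp fjE of_polyD mulrDr !of_polyM.
  rewrite [X in C (_ + X)]mulrCA mul_uvUV_of_poly_exp mulr0 addr0 mulrCA.
  exact: principal_idealM.
have [_ /(_ (N + j)%N)] := Im_least; rewrite leqNgt -addnS le_Im; case/(_ _)/negP => //.
rewrite mul_uvU_of_poly_exp; exact: principal_idealM.
Qed.

(** The minimum weight is constant on ranges of exponents, so the exponent [i] of the light word
    [UV * f ^+ i] may exceed the exponent [Im - N] that serves for the lower bound. *)
Lemma constacyclic_sp_distance (i d : nat) : (0 < d)%N -> (i < N)%N ->
    (Im <= N + i)%N ->
    (pwt (('X - a0%:P) ^+ i) <= d)%N ->
    (forall h : {poly F}, h != 0 -> (size h <= N)%N ->
       ('X - a0%:P) ^+ (Im - N) %| h -> (d <= pwt h)%N) ->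
  is_sp_distance (code_of C) (2 * d).
Proof.
move=> d_gt0 lt_iN le_Im wi wd.
have fE j : f ^+ j = (('X - a0%:P) ^+ j) \Po 'X^2.
  by rewrite !(rmorphXn, rmorphB) /= comp_polyX comp_polyC.
have sfi : (size (f ^+ i) <= n)%N.
  by apply: leq_trans (size_poly_exp_leq _ _) _; rewrite size_XnsubC //=; lia.
apply: (is_sp_distance_ideal (c0 := UV * of_poly (f ^+ i))).
- by rewrite muln_gt0.
- by rewrite of_poly_exp; apply: uvUV_exp_mem.
- by rewrite uvUV_of_poly_neq0 // expf_neq0 // -size_poly_gt0 size_XnsubC.
- apply: leq_trans (d_sp_leq_pwt sfi _) _ => [j|].
    rewrite cc_vecE mxE coef_uvUV_of_poly // coefZ coef_map /=.
    by apply: contraNneq => ->; rewrite raddf0 mulr0.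
  by rewrite fE pwt_comp_polyXn // leq_mul2l.
move=> c Cc /uvUV_socle[b [h [h0 sh bcE hc]]].
apply: (d_sp_geq_pwt sh _ h0) wd => [j|]; first by rewrite cc_vecE mxE => /hc.
(* For [Im < N] the truncated difference is [0], and divisibility by [f ^+ 0] is trivial. *)
rewrite -fE; have [le_NIm|lt_Im] := leqP N Im; last first.
  by rewrite (_ : Im - N = 0)%N ?expr0 ?dvd1p //; apply/eqP; rewrite subn_eq0 ltnW.
apply: uvUV_mem_dvdp; last by rewrite subnKC.
by rewrite -bcE; apply: principal_idealM.
Qed.

End ConstacyclicRing.

Theorem theorem5p6 (p m s : nat) (F : finFieldType)
    (hp : prime p) (hp_odd : odd p) (hm : (0 < m)%N) (hs : (0 < s)%N)
    (hF : #|F| = (p ^ m)%N)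
    (a1 a3 a4 : F) (ha1 : a1 != 0) (ha3 : a3 != 0) (ha4 : a4 != 0)
    (alpha : uv_ring F)
    (halpha : alpha = uvC a1 + uvC a3 * uvV F + uvC a4 * (uvU F * uvV F))
    (halpha_nsq : ~ is_square alpha)
    (a0 : F) (ha0 : a0 ^+ (p ^ s) = a1)
    (l t : nat) (hl : (l <= 2 * p ^ s - 1)%N) (ht : (t < l)%N)
    (z : constacyclic_ring (2 * p ^ s) alpha) :
  let cst (b : F) := ccC (2 * p ^ s) alpha (uvC b) in
  let U := ccC (2 * p ^ s) alpha (uvU F) in
  let X := ccX (2 * p ^ s) alpha in
  let f := X ^+ 2 - cst a0 in
  forall (hz : z = 0 \/
      (is_unit z /\
       exists (N : nat) (z0 z1 : nat -> F),
         cst (z0 0%N) * X + cst (z1 0%N) != 0 /\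
         z = \sum_(k < N) (cst (z0 k) * X + cst (z1 k)) * f ^+ k)),
  let C := principal_ideal (f ^+ l + U * f ^+ t * z) in
  forall (Im : nat) (hIm : is_least (fun k => C (U * f ^+ k)) Im),
  ((Im <= p ^ s)%N -> is_sp_distance (code_of C) 2) /\
  (forall G g : nat,
     (1 <= G <= p - 1)%N -> (0 <= g <= s - 1)%N ->
     (2 * p ^ s - p ^ (s - g) + (G - 1) * p ^ (s - g - 1) + 1 <= Im
        <= 2 * p ^ s - p ^ (s - g) + G * p ^ (s - g - 1))%N ->
     is_sp_distance (code_of C) (2 * (G + 1) * p ^ g)).
Proof.
move=> cst U X f _ C Im hIm.
have pF : p \in [pchar F] by exact: card_finPcharP hF hp.
have p_gt0 := prime_gt0 hp.
have a0_neq0 : a0 != 0.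
  by apply: contraNneq ha1 => a0E; rewrite -ha0 a0E expr0n expn_eq0 -leqn0 leqNgt p_gt0.
subst alpha.
have fE : f = of_poly p s a1 a3 a4 ('X^2 - a0%:P).
  by rewrite [RHS](rmorphB (of_poly p s a1 a3 a4)) /= of_polyC of_poly_exp of_polyX.
have := hIm; rewrite fE => hIm'.
have sp_dist := constacyclic_sp_distance pF hp_odd ha1 ha3 ha0 halpha_nsq hIm'.
split=> [le_Im|G g /andP[G_gt0 lt_Gp] le_gs /andP[ge_Im le_Im]].
  (* Here [UV] itself lies in the ideal, and its single nonzero coordinate meets two pairs. *)
  apply: (sp_dist 0%N 1%N) => //; first by rewrite expn_gt0 p_gt0.
  - by rewrite addn0.
  - by rewrite expr0 -polyC1 pwtC oner_eq0.
  - by move=> h h0 _ _; rewrite pwt_gt0.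
have [s' Ds] : exists s', s = (g + s'.+1)%N by exists (s - g.+1)%N; lia.
rewrite -mulnA; set N := (p ^ s)%N in ge_Im le_Im sp_dist *.
have E1 : (s - g = s'.+1)%N by lia.
have E2 : (s - g - 1 = s')%N by lia.
rewrite E2 E1 in ge_Im le_Im.
have le_sN : (p ^ s'.+1 <= N)%N by rewrite /N Ds leq_pexp2l // leq_addl.
have lt_G : (G * p ^ s' < p ^ s'.+1)%N.
  by rewrite expnS ltn_pmul2r ?expn_gt0 ?p_gt0 //; lia.
(* The light word takes the upper end of the range of [Im], lowered by [N]. *)
apply: (sp_dist (N - p ^ s'.+1 + G * p ^ s')%N).
- by rewrite muln_gt0 expn_gt0 p_gt0 addn1.
- lia.
- lia.
- by rewrite /N Ds addn1 pwt_XsubC_exp_leq //; lia.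
move=> h h0 sh dv.
(* The lower end of the range is the exponent of [leq_pwt_dvdp] for [k = G - 1], whose extra [1] is
   the successor there. *)
rewrite (_ : G + 1 = (G - 1).+2)%N; last by lia.
apply: (leq_pwt_dvdp pF (a := a0) (s := s')) => //; first by rewrite -Ds.
apply: dvdp_trans dv; apply: dvdp_exp2l; rewrite -Ds -/N; lia.
Qed.
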